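(* Let $n\ge 2$. There is a one-to-one correspondence between the families of spherical simplices generating the reflection group $B_n$ (families considered up to isometry) and the trees with $n$ vertices having exactly one marked vertex (considered up to isomorphism preserving the mark). The correspondence is given as follows: realize the family by normal vectors $\pm f_1,\dots,\pm f_n$ which, suitably normalized, lie in the root system $\Delta(B_n)=\{\pm h_i,\ \pm h_i\pm h_j: 1\le i<j\le n\}$ ($h_1,\dots,h_n$ the standard basis of $\mathbb{R}^n$); the associated graph has vertices $v_1,\dots,v_n$ corresponding to $h_1,\dots,h_n$, $v_i$ and $v_j$ are joined by an edge for each of $\pm(h_i+h_j)$, $\pm(h_i-h_j)$ that occurs among the $f_k$, and $v_i$ is marked iff $\pm h_i$ occurs among the $f_k$. This correspondence is well defined and is a bijection onto the set of trees with $n$ vertices and exactly one marked vertex.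
   Context: A family of spherical simplices in $S^{n-1}$ is the set of $2^n$ simplices cut out by $n$ hyperplanes through the origin in $\mathbb{R}^n$ with linearly independent unit normals $f_1,\dots,f_n$; it is encoded by $\pm f_1,\dots,\pm f_n$. The family generates the group generated by the reflections in the hyperplanes $f_i^\perp$; it generates $B_n$ if this group is the finite Coxeter (Weyl) group of type $B_n$ (up to conjugation by an orthogonal transformation). *)

(* Defs.v *)
From HB Require Import structures.
From mathcomp Require Import all_boot all_order all_algebra fingroup perm.
From mathcomp Require Import reals.
Set Implicit Arguments. Unset Strict Implicit. Unset Printing Implicit Defensive.
Import Order.TTheory GRing.Theory Num.Theory.
Local Open Scope ring_scope.

Section BnFamilies.
Variable R : realType.
Variable n : nat.

Definition hvec (i : 'I_n) : 'rV[R]_n := delta_mx 0 i.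

Definition is_root_Bn (v : 'rV[R]_n) : Prop :=
  (exists i, v = hvec i \/ v = - hvec i) \/
  (exists i j, i != j /\
     (v = hvec i + hvec j \/ v = hvec i - hvec j \/
      v = - hvec i + hvec j \/ v = - hvec i - hvec j)).

Definition refl (f : 'rV[R]_n) : 'M[R]_n :=
  1%:M - (2 / (f *m f^T) 0 0) *: (f^T *m f).

Inductive gen_by (P : 'rV[R]_n -> Prop) : 'M[R]_n -> Prop :=
| gen_one : gen_by P 1%:M
| gen_mul M f : gen_by P M -> P f -> gen_by P (M *m refl f).

Definition WBn : 'M[R]_n -> Prop := gen_by is_root_Bn.

Definition orthogonal_mx (Q : 'M[R]_n) : Prop := Q *m Q^T = 1%:M.

(* A family of spherical simplices is encoded by the matrix F whose rows are
   the linearly independent unit normals f_1, ..., f_n. *)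
Definition is_family (F : 'M[R]_n) : Prop :=
  F \in unitmx /\ forall k, row k F *m (row k F)^T = 1%:M.

Definition fam_group (F : 'M[R]_n) : 'M[R]_n -> Prop :=
  gen_by (fun v => exists k, v = row k F).

Definition generates_Bn (F : 'M[R]_n) : Prop :=
  exists Q, orthogonal_mx Q /\
    (forall M, fam_group F M -> WBn (Q^T *m M *m Q)) /\
    (forall N, WBn N -> fam_group F (Q *m N *m Q^T)).

Definition isometric (F F' : 'M[R]_n) : Prop :=
  exists Q, orthogonal_mx Q /\ exists s : 'S_n,
    forall k, row k F *m Q = row (s k) F' \/ row k F *m Q = - row (s k) F'.

Definition standard (F : 'M[R]_n) : Prop :=
  forall k, exists (c : R) (r : 'rV[R]_n), is_root_Bn r /\ row k F = c *: r.

(* the line R v occurs among the f_k *)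
Definition occurs (F : 'M[R]_n) (v : 'rV[R]_n) : bool :=
  [exists k, (row k F == v)%MS].

Definition mark_of (F : 'M[R]_n) (i : 'I_n) : bool := occurs F (hvec i).

Definition mult_of (F : 'M[R]_n) (i j : 'I_n) : nat :=
  if i == j then 0%N
  else (occurs F (hvec i + hvec j) + occurs F (hvec i - hvec j))%N.

(* multigraphs on 'I_n given by edge multiplicities *)
Definition adj (m : 'I_n -> 'I_n -> nat) : rel 'I_n := fun i j => (0 < m i j)%N.

Definition is_tree (m : 'I_n -> 'I_n -> nat) : Prop :=
  [/\ forall i, m i i = 0%N,
      forall i j, m i j = m j i,
      forall i j, (m i j <= 1)%N,
      forall i j, connect (adj m) i j &
      ~ exists s : seq 'I_n, [/\ uniq s, (2 < size s)%N & path.cycle (adj m) s]].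

Definition one_marked (mk : 'I_n -> bool) : Prop := #|[set i | mk i]| = 1%N.

Definition mg_iso (m : 'I_n -> 'I_n -> nat) (mk : 'I_n -> bool)
  (m' : 'I_n -> 'I_n -> nat) (mk' : 'I_n -> bool) : Prop :=
  exists s : 'S_n, (forall i j, m' (s i) (s j) = m i j) /\
                   (forall i, mk' (s i) = mk i).

End BnFamilies.

(* Main.v *)
Require Import Defs.
From HB Require Import structures.
From mathcomp Require Import all_boot all_order all_algebra fingroup perm.
From mathcomp Require Import reals.
From mathcomp Require Import ring lra.
Set Implicit Arguments. Unset Strict Implicit. Unset Printing Implicit Defensive.
Import Order.TTheory GRing.Theory Num.Theory.
Local Open Scope ring_scope.

(* A family in normal form is a graph on the coordinates.  Connectedness: the projection
   onto a component commutes with the group, whereas the centralizer of W(B_n) is scalar.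
   Some vertex is marked: otherwise the group lies in W(D_n), which contains no conjugate of
   W(B_n).  Root the graph at a marked vertex r and pick a parent p(v) of each v <> r nearer
   to r: the line of h_r and one line of h_v + h_p(v) or h_v - h_p(v) for every v <> r already
   account for all n normals, so the graph is the tree of parent edges and r is the only mark.
   Conversely such a family generates every reflection of W(B_n), by induction on the depth.
   For n >= 3 an orthogonal matrix conjugating W(B_n) into itself is a signed permutation,
   hence induces a graph isomorphism; for n = 2 there is only one marked tree.  In the other
   direction a graph isomorphism lifts to an isometry, the signs of the edges being adjusted
   recursively from the root. *)

(** * Rooted trees *)

Section RootedTrees.
Variable n : nat.
Implicit Types (r : 'I_n) (p : 'I_n -> 'I_n) (d : 'I_n -> nat).
Implicit Types (m : 'I_n -> 'I_n -> nat).

(** [d] is any rank that drops along [p], not necessarily the depth. The convention [p r = r] makes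
    [[set r; p r]] a singleton, so that the mark and the edges can be treated uniformly. *)
Definition parent_fun r p d : Prop :=
  p r = r /\ forall v, v != r -> (d (p v) < d v)%N.

(** The guards discard the loop that [p r = r] would create. *)
Definition parent_adj r p : rel 'I_n := fun i j =>
  ((i != r) && (p i == j)) || ((j != r) && (p j == i)).

Lemma parent_adjC r p i j : parent_adj r p i j = parent_adj r p j i.
Proof. by rewrite /parent_adj orbC. Qed.

Lemma parent_fun_ind r p d (P : 'I_n -> Prop) : parent_fun r p d ->
  P r -> (forall v, v != r -> P (p v) -> P v) -> forall v, P v.
Proof.
move=> [_ pd] Pr Pp v; have [k] := ubnP (d v); elim: k v => // k IH v lt_dk.
have [-> // | nvr] := eqVneq v r.
by apply: Pp => //; apply: IH; apply: leq_trans (pd v nvr) _.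
Qed.

Lemma parent_neq r p d v : parent_fun r p d -> v != r -> p v != v.
Proof. by move=> [_ pd] /pd; apply: contraTneq => ->; rewrite ltnn. Qed.

(** Distinct vertices with the same pair would be parents of each other, and [d] would drop both
    ways. This recovers a vertex from the support of its normal. *)
Lemma set2_parent_inj r p d : parent_fun r p d ->
  injective (fun v => [set v; p v]).
Proof.
move=> pf v w e.
have: v \in [set w; p w] by rewrite -e !inE eqxx.
have: w \in [set v; p v] by rewrite e !inE eqxx.
rewrite !inE => /orP[/eqP-> // | /eqP ew] /orP[/eqP // | /eqP ev].
have [pr pd] := pf; have [ewr | nwr] := eqVneq w r; first by rewrite ev ewr pr.
have [evr | nvr] := eqVneq v r; first by rewrite ew evr pr.
have := pd v nvr; have := pd w nwr; rewrite -ew -ev => h1 h2.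
by have := ltn_trans h1 h2; rewrite ltnn.
Qed.

Lemma parent_connect r p d (e : rel 'I_n) : parent_fun r p d -> symmetric e ->
  (forall v, v != r -> e v (p v)) -> forall i j, connect e i j.
Proof.
move=> pf se ep i j; have cr: forall v, connect e v r.
  apply: (parent_fun_ind pf) => // v nvr; apply: connect_trans.
  exact/connect1/ep.
by apply: (connect_trans (cr i)); rewrite sym_connect_sym.
Qed.

(** At a vertex of maximal [d] on a cycle, both neighbours would be its parent, hence equal. *)
Lemma parent_tree r p d m : parent_fun r p d ->
  (forall i j, m i j = parent_adj r p i j) -> is_tree m.
Proof.
move=> pf mE.
have adjE: adj m =2 parent_adj r p by move=> i j; rewrite /adj mE lt0b.
have adj_d v x : (d x <= d v)%N -> adj m v x -> p v = x.
  rewrite adjE => le_d /orP[/andP[_ /eqP//] | /andP[nxr /eqP pxv]].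
  by have [_ /(_ x nxr)] := pf; rewrite pxv ltnNge le_d.
have sym: symmetric (adj m) by move=> i j; rewrite !adjE parent_adjC.
split.
- move=> i; rewrite mE /parent_adj orbb.
  by have [// | /(parent_neq pf) /negPf->] := eqVneq i r.
- by move=> i j; rewrite !mE parent_adjC.
- by move=> i j; rewrite mE leq_b1.
- apply: (parent_connect pf sym) => v nvr.
  by rewrite adjE /parent_adj nvr eqxx.
case=> s [us s2 cs].
case: s us s2 cs => // v0 s us s2 cs.
have [v vs vmax]: exists2 v, v \in v0 :: s & forall x, x \in v0 :: s -> (d x <= d v)%N.
  have v0s: v0 \in v0 :: s by rewrite mem_head.
  by case: (@arg_maxnP _ v0 [in v0 :: s] d v0s) => v vs vmax; exists v.
(* The cycle is rotated to start at [v]; its neighbours are then the second vertex [x] and the last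
   vertex [y]. *)
have [i s' rs] := rot_to vs.
have: path.cycle (adj m) (v :: s') by rewrite -rs rot_cycle.
have: uniq (v :: s') by rewrite -rs rot_uniq.
have: (2 < size (v :: s'))%N by rewrite -rs size_rot.
have: forall x, x \in v :: s' -> (d x <= d v)%N.
  by move=> x; rewrite -rs mem_rot; apply: vmax.
case: s' {rs} => // x s'; case/lastP: s' => // s' y dmax _ us' /=.
rewrite rcons_path => /andP[vx /andP[_ ylast]].
move: ylast; rewrite last_rcons sym => vy.
have ex: p v = x by apply: adj_d vx; apply: dmax; rewrite !inE eqxx orbT.
have ey: p v = y by apply: adj_d vy; apply: dmax; rewrite !inE mem_rcons mem_head !orbT.
by move: us'; rewrite /= -ex ey mem_rcons mem_head andbF.
Qed.

(** Here [d] is the length of a shortest path to [r], and [p v] is the vertex that follows [v] on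
    such a path. *)
Lemma connected_parent (e : rel 'I_n) r : (forall v, connect e v r) ->
  exists p d, parent_fun r p d /\ forall v, v != r -> e v (p v).
Proof.
move=> cr; pose P v k := [exists t : k.-tuple 'I_n, path e v t && (last v t == r)].
have exP v: exists k, P v k.
  have /connectP[s ps er] := cr v; exists (size s).
  by apply/existsP; exists (in_tuple s); rewrite ps -er eqxx.
pose d v := ex_minn (exP v).
have step v: exists w, (v == r -> w = r) /\ (v != r -> (d w < d v)%N /\ e v w).
  have [-> | nvr] := eqVneq v r; first by exists r.
  rewrite {2}/d; case: ex_minnP => k /existsP[t /andP[pt lt]] _.
  case: k t pt lt => [t | k]; first by rewrite tuple0 /= (negPf nvr).
  case/tupleP=> w t /= /andP[evw pt] lt; exists w; split=> // _; split=> //.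
  rewrite /d; case: ex_minnP => k' _ /(_ k); rewrite ltnS; apply.
  by apply/existsP; exists t; rewrite pt.
have [p pP] := fin_all_exists step; exists p, d; split; first split.
- by have [-> //] := pP r.
- by move=> v /(proj2 (pP v))[].
- by move=> v /(proj2 (pP v))[].
Qed.

(* In a tree every edge is a bridge: deleting a non-parent edge would leave the graph
   connected through the parent edges, and a path around it would close up to a cycle. *)
Lemma tree_parent m r : is_tree m ->
  exists p d, parent_fun r p d /\ forall i j, m i j = parent_adj r p i j.
Proof.
move=> [m0 msym m1 mconn macyc].
have [p [d [pf ep]]] := connected_parent (fun v => mconn v r).
exists p, d; split=> // i j.
have sym: symmetric (adj m) by move=> x y; rewrite /adj msym.
case: (boolP (parent_adj r p i j)) => [pij | npij].
  have: adj m i j.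
    case/orP: pij => /andP[/ep]; first by move=> eip /eqP<-.
    by move=> eip /eqP<-; rewrite sym.
  by rewrite /adj; case: (m i j) (m1 i j) => [|[]].
apply/eqP; rewrite -leqn0 leqNgt; apply/negP; rewrite -/(adj m i j) => mij.
have nij: i != j by apply: contraTneq mij => ->; rewrite /adj m0.
pose e' : rel 'I_n := fun x y =>
  adj m x y && ~~ ((x == i) && (y == j) || (x == j) && (y == i)).
have sym': symmetric e'.
  by move=> x y; rewrite /e' sym; congr (_ && ~~ _); rewrite orbC andbC [X in _ || X]andbC.
have ep' v: v != r -> e' v (p v).
  move=> nvr; rewrite /e' ep //=; apply: contra npij.
  by case/orP=> /andP[/eqP<- /eqP<-]; rewrite /parent_adj nvr eqxx ?orbT.
have /connectP[s0 ps0 els0] := parent_connect pf sym' ep' i j.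
move: els0; case/shortenP: ps0 => s ps us _ els.
case: macyc; exists (i :: s); split=> //.
  (* The path has at least two edges: [i] differs from [j], and the edge between them is deleted in
     [e']. *)
  case: s ps us els => [_ _ /= e|x s]; first by rewrite e eqxx in nij.
  case: s => //= /andP[ij _] _ ejx; move: ij; rewrite -ejx /e' !eqxx /=.
  by rewrite andbF.
rewrite /= rcons_path -els sym mij andbT.
by apply: sub_path ps => x y /andP[].
Qed.

End RootedTrees.

(** * Reflections and signed permutations *)

Section Reflections.
Variables (R : realType) (n : nat).
Implicit Types (f g u v w : 'rV[R]_n) (M N Q : 'M[R]_n) (P : 'rV[R]_n -> Prop).
Local Notation h := (@hvec R n).

Definition dot u v : R := (u *m v^T) 0 0.

(** Up to a scalar, every long root has this form; with a boolean sign, signs multiply by [(+)]. *)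
Definition dvec (e : bool) (i j : 'I_n) : 'rV[R]_n := h i + (-1) ^+ e *: h j.

Lemma dotE u v : dot u v = \sum_k u 0 k * v 0 k.
Proof. by rewrite /dot mxE; apply: eq_bigr => k _; rewrite mxE. Qed.

Lemma dotC u v : dot u v = dot v u.
Proof. by rewrite !dotE; apply: eq_bigr => k _; rewrite mulrC. Qed.

Lemma dotDl u v w : dot (u + v) w = dot u w + dot v w.
Proof. by rewrite /dot mulmxDl mxE. Qed.

Lemma dotZl c u w : dot (c *: u) w = c * dot u w.
Proof. by rewrite /dot -scalemxAl mxE. Qed.

Lemma dotDr u v w : dot w (u + v) = dot w u + dot w v.
Proof. by rewrite dotC dotDl !(dotC w). Qed.

Lemma dotZr c u w : dot w (c *: u) = c * dot w u.
Proof. by rewrite dotC dotZl dotC. Qed.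

Lemma mulmx_dot u v : u *m v^T = (dot u v)%:M.
Proof. exact: mx11_scalar. Qed.

Lemma hvecE i j : h i 0 j = (i == j)%:R.
Proof. by rewrite mxE eqxx eq_sym. Qed.

Lemma dot_hvec u i : dot u (h i) = u 0 i.
Proof.
rewrite dotE (bigD1 i) //= hvecE eqxx mulr1 big1 ?addr0 // => k nki.
by rewrite hvecE eq_sym (negPf nki) mulr0.
Qed.

Lemma dot_ge v i : v 0 i ^+ 2 <= dot v v.
Proof.
rewrite dotE (bigD1 i) //= expr2 lerDl sumr_ge0 // => k _.
by rewrite -expr2 sqr_ge0.
Qed.

Lemma dot_eq0 v : (dot v v == 0) = (v == 0).
Proof.
apply/eqP/eqP => [d0 | ->]; last by rewrite /dot mul0mx mxE.
apply/rowP => i; rewrite mxE; apply/eqP; rewrite -sqrf_eq0 eq_le sqr_ge0 andbT.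
by rewrite -d0 dot_ge.
Qed.

Lemma sqr_sign (e : bool) : ((-1) ^+ e : R) ^+ 2 = 1.
Proof. by case: e; rewrite ?expr1 ?sqrrN expr1n. Qed.

Lemma dvecE e i j k : dvec e i j 0 k = (i == k)%:R + (-1) ^+ e * (j == k)%:R.
Proof. by rewrite mxE hvecE mxE hvecE. Qed.

Lemma dot_hh i j : dot (h i) (h j) = (i == j)%:R.
Proof. by rewrite dot_hvec hvecE. Qed.

Lemma dot_dvec e i j : i != j -> dot (dvec e i j) (dvec e i j) = 2.
Proof.
move=> nij; rewrite /dvec dotDl !dotDr !dotZl !dotZr !dot_hh !eqxx (eq_sym j).
by rewrite (negPf nij) !mulr0 addr0 add0r mulr1 -expr2 sqr_sign.
Qed.

Lemma dvecC e i j : dvec e i j = (-1) ^+ e *: dvec e j i.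
Proof. by rewrite /dvec scalerDr scalerA -expr2 sqr_sign scale1r addrC. Qed.

Lemma hvec_neq0 i : h i != 0.
Proof. by rewrite -dot_eq0 dot_hh eqxx oner_eq0. Qed.

Lemma dvec_neq0 e i j : i != j -> dvec e i j != 0.
Proof. by move=> nij; rewrite -dot_eq0 dot_dvec // pnatr_eq0. Qed.

Lemma rowh i M : row i M = h i *m M.
Proof. by rewrite rowE. Qed.

Lemma hvec_mulE i M a : (h i *m M) 0 a = M i a.
Proof. by rewrite -rowh mxE. Qed.

Lemma dvec_mulE e i j M a : (dvec e i j *m M) 0 a = M i a + (-1) ^+ e * M j a.
Proof. by rewrite /dvec mulmxDl -scalemxAl mxE [X in _ + X]mxE !hvec_mulE. Qed.

Lemma mul_refl g f : g *m refl f = g - (2 / dot f f * dot g f) *: f.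
Proof.
rewrite /refl mulmxBr mulmx1 -scalemxAr mulmxA (mulmx_dot g) mul_scalar_mx scalerA.
by [].
Qed.

Lemma refl_entry f i j : refl f i j = (i == j)%:R - 2 / dot f f * (f 0 i * f 0 j).
Proof. by rewrite /refl -/(dot f f) !mxE big_ord1 !mxE. Qed.

Lemma tr_refl f : (refl f)^T = refl f.
Proof.
by rewrite /refl linearB /= trmx1 linearZ /= trmx_mul trmxK.
Qed.

Lemma reflZ c f : c != 0 -> refl (c *: f) = refl f.
Proof.
move=> c0; apply/matrixP => i j; rewrite !refl_entry !mxE dotZl dotZr.
(* For [dot f f = 0] the convention [0^-1 = 0] makes both sides the identity. *)
have [->|d0] := eqVneq (dot f f) 0; first by rewrite !mulr0 invr0 !mulr0 !mul0r.
by field; rewrite d0 c0.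
Qed.

Lemma refl_orth f : orthogonal_mx (refl f).
Proof.
rewrite /orthogonal_mx tr_refl; apply/row_matrixP => i.
rewrite !rowh mulmxA !mul_refl mulmx1 dotDl -scaleNr dotZl.
have [->|d0] := eqVneq (dot f f) 0; first by rewrite invr0 !(mulr0, mul0r) oppr0 scale0r oppr0 !addr0.
rewrite -addrA -scalerBl -[RHS]addr0; congr (_ + _).
apply/eqP; rewrite scaler_eq0; apply/orP; left; apply/eqP.
by field.
Qed.

(** * Orthogonal matrices and groups generated by reflections *)

Lemma orth_tr Q : orthogonal_mx Q -> orthogonal_mx Q^T.
Proof. by rewrite /orthogonal_mx trmxK; apply: mulmx1C. Qed.

Lemma orth_trmul Q : orthogonal_mx Q -> Q^T *m Q = 1%:M.
Proof. exact: mulmx1C. Qed.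

Lemma dot_orth Q u v : orthogonal_mx Q -> dot (u *m Q) (v *m Q) = dot u v.
Proof.
by move=> oQ; rewrite /dot trmx_mul mulmxA -(mulmxA u) oQ mulmx1.
Qed.

Lemma refl_mul Q f : orthogonal_mx Q -> refl (f *m Q) = Q^T *m refl f *m Q.
Proof.
move=> oQ; rewrite /refl mulmxBr mulmxBl mulmx1 orth_trmul //.
have -> : (f *m Q *m (f *m Q)^T) 0 0 = dot f f by rewrite -[LHS]/(dot _ _) dot_orth.
by rewrite trmx_mul -scalemxAr -scalemxAl !mulmxA.
Qed.

Lemma gen_refl P f : P f -> gen_by P (refl f).
Proof. by move=> Pf; rewrite -[refl f]mul1mx; apply: gen_mul (gen_one _) Pf. Qed.

Lemma gen_mulmx P M N : gen_by P M -> gen_by P N -> gen_by P (M *m N).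
Proof.
move=> gM; elim=> [|N' f _ IH Pf]; first by rewrite mulmx1.
by rewrite mulmxA; apply: gen_mul.
Qed.

Lemma gen_conj P P' Q M : orthogonal_mx Q ->
  (forall f, P f -> gen_by P' (refl (f *m Q))) ->
  gen_by P M -> gen_by P' (Q^T *m M *m Q).
Proof.
move=> oQ PP'; elim=> [|N f _ IH Pf].
  by rewrite mulmx1 orth_trmul //; apply: gen_one.
have -> : Q^T *m (N *m refl f) *m Q = (Q^T *m N *m Q) *m (Q^T *m refl f *m Q).
  by rewrite !mulmxA -(mulmxA (Q^T *m N) Q) oQ mulmx1.
by apply: gen_mulmx IH _; rewrite -refl_mul //; apply: PP'.
Qed.

Lemma gen_sub P P' M :
  (forall f, P f -> gen_by P' (refl f)) -> gen_by P M -> gen_by P' M.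
Proof.
move=> PP' gM; have o1: @orthogonal_mx R n 1%:M by rewrite /orthogonal_mx trmx1 mulmx1.
rewrite -[M]mulmx1 -[M]mul1mx -{1}(trmx1 R n); apply: gen_conj o1 _ gM.
by move=> f /PP'; rewrite mulmx1.
Qed.

(** The reflection in [g *m refl f] is the conjugate of [refl g] by [refl f]; new root reflections
    are produced in this way. *)
Lemma gen_refl_mul P f g : gen_by P (refl f) -> gen_by P (refl g) ->
  gen_by P (refl (g *m refl f)).
Proof.
move=> gf gg; rewrite refl_mul; last exact: refl_orth.
by rewrite tr_refl; apply: gen_mulmx => //; apply: gen_mulmx.
Qed.

Lemma mul_refl_hvec i a : h i *m refl (h a) = (-1) ^+ (i == a) *: h i.
Proof.
rewrite mul_refl !dot_hh eqxx divr1; have [->|_] := eqVneq i a.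
  by rewrite mulr1 expr1 -[X in X - _]scale1r -scalerBl; congr (_ *: _); ring.
by rewrite mulr0 scale0r subr0 scale1r.
Qed.

Lemma mul_refl_dvec u e a b : a != b ->
  u *m refl (dvec e a b) = u - (u 0 a + (-1) ^+ e * u 0 b) *: dvec e a b.
Proof.
move=> nab; rewrite mul_refl dot_dvec // divff ?pnatr_eq0 // mul1r /dvec dotDr dotZr.
by rewrite !dot_hvec.
Qed.

Lemma hvec_refl_dvecl e a b : a != b ->
  h a *m refl (dvec e a b) = (-1) ^+ (~~ e) *: h b.
Proof.
move=> nab; rewrite mul_refl_dvec // !hvecE eqxx (negPf nab) mulr0 addr0 scale1r.
by rewrite /dvec opprD addrA subrr add0r signrN scaleNr.
Qed.

Lemma hvec_refl_dvecr e a b : a != b ->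
  h b *m refl (dvec e a b) = (-1) ^+ (~~ e) *: h a.
Proof.
move=> nab; rewrite dvecC reflZ ?signr_eq0 //; apply: hvec_refl_dvecl.
by rewrite eq_sym.
Qed.

Lemma hvec_refl_dvec_id e a b i : a != b -> i != a -> i != b ->
  h i *m refl (dvec e a b) = h i.
Proof.
move=> nab nia nib; rewrite mul_refl_dvec // !hvecE (negPf nia) (negPf nib).
by rewrite mulr0 addr0 scale0r subr0.
Qed.

Lemma is_root_dvec e i j : i != j -> is_root_Bn (dvec e i j).
Proof.
move=> nij; right; exists i, j; split=> //.
by case: e; rewrite /dvec ?scaleN1r ?scale1r; [right; left | left].
Qed.

Lemma is_root_hvec i : is_root_Bn (h i).
Proof. by left; exists i; left. Qed.

Lemma is_rootP v : is_root_Bn v -> exists c : R, c != 0 /\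
  ((exists i, v = c *: h i) \/ (exists e i j, i != j /\ v = c *: dvec e i j)).
Proof.
have n1: (-1 : R) != 0 by rewrite oppr_eq0 oner_eq0.
case=> [[i [->|->]] | [i [j [nij vE]]]].
- by exists 1; split; [exact: oner_neq0 | left; exists i; rewrite scale1r].
- by exists (-1); split=> //; left; exists i; rewrite scaleN1r.
case: vE => [->|[->|[->|->]]].
- exists 1; split; first exact: oner_neq0.
  by right; exists false, i, j; rewrite /dvec !scale1r.
- exists 1; split; first exact: oner_neq0.
  by right; exists true, i, j; rewrite /dvec scale1r scaleN1r.
- exists (-1); split=> //; right; exists true, i, j; split=> //.
  by rewrite /dvec !scaleN1r opprD opprK.
- exists (-1); split=> //; right; exists false, i, j; split=> //.
  by rewrite /dvec scaleN1r scale1r opprD.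
Qed.

Lemma WBn_refl c v : c != 0 -> is_root_Bn v -> WBn (refl (c *: v)).
Proof. by move=> c0 rv; rewrite reflZ //; apply: gen_refl. Qed.

(** For orthogonal [M] this means a signed permutation matrix, the injectivity coming from the
    orthogonality. *)
Definition permutes_axes M := forall i, exists j (e : bool), h i *m M = (-1) ^+ e *: h j.

Lemma WBn_axes M : WBn M -> permutes_axes M.
Proof.
elim=> [|N f _ IH rf] i; first by exists i, false; rewrite mulmx1 scale1r.
have [j [e ej]] := IH i; rewrite mulmxA ej -scalemxAl.
suff [k [e' ->]]: exists k (e' : bool), h j *m refl f = (-1) ^+ e' *: h k.
  by exists k, (e (+) e'); rewrite scalerA signr_addb.
have [c [c0 [[a ->] | [e' [a [b [nab ->]]]]]]] := is_rootP rf; rewrite reflZ //.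
  by exists j, (j == a); rewrite mul_refl_hvec.
have [->|nja] := eqVneq j a; first by exists b, (~~ e'); rewrite hvec_refl_dvecl.
have [->|njb] := eqVneq j b; first by exists a, (~~ e'); rewrite hvec_refl_dvecr.
by exists j, false; rewrite hvec_refl_dvec_id // scale1r.
Qed.

Lemma axes_entry M i j k : permutes_axes M -> M i j != 0 -> M i k != 0 -> j = k.
Proof.
move=> /(_ i)[l [e eM]].
have E q : M i q = (-1) ^+ e * (l == q)%:R.
  have := congr1 (fun v : 'rV_n => v 0 q) eM; rewrite -rowh mxE => ->.
  by rewrite mxE hvecE.
rewrite !E; case: (eqVneq l j) => [<-|_]; last by rewrite mulr0 eqxx.
by case: (eqVneq l k) => [<-|_] //; rewrite mulr0 eqxx.
Qed.

(* The entries of [refl v] are [(i == j) - 2 v_i v_j / |v|^2]; since every row has a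
   single non-zero entry, [v] has at most two non-zero coordinates, of the same size. *)
Lemma refl_axes v : v != 0 -> permutes_axes (refl v) ->
  (exists a, v = v 0 a *: h a) \/
  (exists e a b, a != b /\ v = v 0 a *: dvec e a b).
Proof.
move=> v0 av; have d0: dot v v != 0 by rewrite dot_eq0.
have off i j : i != j -> (refl v i j == 0) = (v 0 i * v 0 j == 0).
  move=> nij; rewrite refl_entry (negPf nij) sub0r oppr_eq0 mulf_eq0.
  by rewrite mulf_eq0 invr_eq0 pnatr_eq0 (negPf d0).
have [a va]: exists a, v 0 a != 0.
  by apply/existsP; apply: contraNT v0; rewrite negb_exists => /forallP v0;
     apply/eqP/rowP => i; rewrite mxE; apply/eqP; move: (v0 i); rewrite negbK.
have [/existsP[b /andP[nba vb]] | /existsPn vz] :=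
    boolP [exists b, (b != a) && (v 0 b != 0)]; last first.
  left; exists a; apply/rowP => i; rewrite mxE hvecE.
  have [<-|nai] := eqVneq a i; first by rewrite mulr1.
  by move: (vz i); rewrite eq_sym nai /= negbK => /eqP->; rewrite mulr0.
right.
(* A nonzero off-diagonal entry in row [i] forces the diagonal entry [1 - 2 v_i^2 / |v|^2] to
   vanish. *)
have diag i j : i != j -> v 0 i != 0 -> v 0 j != 0 -> 2 * v 0 i ^+ 2 = dot v v.
  move=> nij vi vj; have Mij: refl v i j != 0 by rewrite off // mulf_neq0.
  have /eqP: refl v i i == 0.
    by apply: contraNT nij => Mii; rewrite (axes_entry av Mii Mij).
  rewrite refl_entry eqxx => /eqP; rewrite subr_eq0 => /eqP e.
  by have := congr1 (fun x => x * dot v v) e; rewrite mul1r => ->; field.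
have third c : c != a -> c != b -> v 0 c = 0.
  move=> nca ncb; apply/eqP; apply: contraNT ncb => vc.
  have nac: a != c by rewrite eq_sym.
  have nab: a != b by rewrite eq_sym.
  by apply/eqP/(@axes_entry (refl v) a) => //; rewrite off // mulf_neq0.
have nab: a != b by rewrite eq_sym.
have e1 := diag a b nab va vb; have e2 := diag b a nba vb va.
have : v 0 b ^+ 2 == v 0 a ^+ 2.
  by apply/eqP/(@mulfI _ 2); rewrite ?pnatr_eq0 // e1 e2.
rewrite eqf_sqr => eab.
have [e ve]: exists e : bool, v 0 b = (-1) ^+ e * v 0 a.
  by case/orP: eab => /eqP->; [exists false; rewrite mul1r | exists true; rewrite mulN1r].
exists e, a, b; split=> //; apply/rowP => c; rewrite mxE dvecE.
have [<-|nac] := eqVneq a c; first by rewrite eq_sym (negPf nab) mulr0 addr0 mulr1.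
have [<-|nbc] := eqVneq b c; first by rewrite add0r mulr1 ve mulrC.
by rewrite mulr0 addr0 mulr0 third // eq_sym.
Qed.

End Reflections.

(** * The graph of a standard family *)

Section Families.
Variables (R : realType) (n : nat).
Implicit Types (f g u v w : 'rV[R]_n) (F M N Q : 'M[R]_n).
Local Notation h := (@hvec R n).

(** For a multiple of a root, this is the marked vertex or the edge it stands for, with scalar and
    sign forgotten. *)
Definition vsupp v : {set 'I_n} := [set i | v 0 i != 0].

Lemma vsuppZ c v : c != 0 -> vsupp (c *: v) = vsupp v.
Proof. by move=> c0; apply/setP => i; rewrite !inE mxE mulf_eq0 (negPf c0). Qed.

Lemma vsupp_hvec i : vsupp (h i) = [set i].
Proof. by apply/setP => j; rewrite !inE hvecE pnatr_eq0 eqb0 negbK eq_sym. Qed.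

Lemma vsupp_dvec e i j : i != j -> vsupp (dvec R e i j) = [set i; j].
Proof.
move=> nij; apply/setP => k; rewrite !inE dvecE (eq_sym k) (eq_sym k).
have [<-|_] := eqVneq i k; first by rewrite (eq_sym j) (negPf nij) mulr0 addr0 oner_neq0.
by have [_|_] := eqVneq j k; rewrite add0r ?mulr1 ?signr_eq0 // mulr0 eqxx.
Qed.

Lemma family_dot F k : is_family F -> dot (row k F) (row k F) = 1.
Proof. by case=> _ /(_ k); rewrite /dot => ->; rewrite mxE. Qed.

Lemma family_row_neq0 F k : is_family F -> row k F != 0.
Proof. by move=> fF; rewrite -dot_eq0 family_dot // oner_eq0. Qed.

Lemma occursP F v : is_family F ->
  reflect (exists k c, c != 0 /\ row k F = c *: v) (occurs F v).
Proof.
move=> fF; apply: (iffP existsP) => [[k /andP[/sub_rVP[c ec] _]] | [k [c [c0 ec]]]].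
  exists k, c; split=> //; apply: contraTneq isT => c0.
  by have := family_row_neq0 k fF; rewrite ec c0 scale0r eqxx.
by exists k; rewrite ec; apply/eqmxP/eqmx_scale.
Qed.

Lemma occursZ F c v : c != 0 -> occurs F (c *: v) = occurs F v.
Proof.
by move=> c0; apply: eq_existsb => k; rewrite !(eqmx_scale v c0).
Qed.

Lemma mult_ofE F i j : mult_of F i j =
  if i == j then 0%N else (occurs F (dvec R false i j) + occurs F (dvec R true i j))%N.
Proof. by rewrite /mult_of /dvec scale1r scaleN1r. Qed.

Lemma mult_ofC F i j : mult_of F i j = mult_of F j i.
Proof.
rewrite !mult_ofE eq_sym; case: ifP => // _.
by rewrite !(dvecC _ _ j i) !occursZ ?signr_eq0.
Qed.

Lemma mult_of_gt0 F i j : (0 < mult_of F i j)%N ->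
  i != j /\ exists e, occurs F (dvec R e i j).
Proof.
rewrite mult_ofE; case: eqVneq => // nij; rewrite addn_gt0 => /orP[] o; split=> //.
  by exists false; move: o; case: occurs.
by exists true; move: o; case: occurs.
Qed.

Lemma occurs_mult_of F e i j : i != j -> occurs F (dvec R e i j) -> (0 < mult_of F i j)%N.
Proof. by rewrite mult_ofE => /negPf-> o; case: e o => ->; rewrite ?addn1. Qed.

Lemma standard_row F k : is_family F -> standard F -> exists c : R, c != 0 /\
  ((exists i, row k F = c *: h i) \/ (exists e i j, i != j /\ row k F = c *: dvec R e i j)).
Proof.
move=> fF /(_ k)[c [v [/is_rootP[c' [c'0 rv]] e]]]; exists (c * c'); split.
  apply: contraTneq (family_row_neq0 k fF); rewrite e negbK => /eqP.
  by rewrite mulf_eq0 (negPf c'0) orbF => /eqP->; rewrite scale0r.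
case: rv => [[i vi] | [e' [i [j [nij vij]]]]].
  by left; exists i; rewrite e vi scalerA.
by right; exists e', i, j; split=> //; rewrite e vij scalerA.
Qed.

Lemma standard_WBn F M : is_family F -> standard F -> fam_group F M -> WBn M.
Proof.
move=> fF sF; apply: gen_sub => f [k ->].
have [c [c0 [[i ->] | [e [i [j [nij ->]]]]]]] := standard_row k fF sF; apply: WBn_refl => //.
  exact: is_root_hvec.
exact: is_root_dvec.
Qed.

(** [X] preserves the eigenspace of [refl v] for the eigenvalue -1, which is the line of [v]. *)
Lemma refl_comm_eigen X v : v != 0 -> X *m refl v = refl v *m X ->
  exists l, v *m X = l *: v.
Proof.
move=> v0 cX; have := congr1 (mulmx v) cX.
rewrite !mulmxA !mul_refl divfK ?dot_eq0 // scaler_nat mulr2n opprD addrA subrr add0r.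
rewrite mulNmx; set s := (_ * dot (v *m X) v) => e; exists (2^-1 * s).
have e2 : v *m X + v *m X = s *: v.
  by rewrite -[X in X + _](subrK (s *: v)) e addrAC addNr add0r.
by rewrite -scalerA -e2 -mulr2n -scaler_nat scalerA mulVf ?pnatr_eq0 // scale1r.
Qed.

(** The roots [h i] make [X] diagonal, and the roots [h i + h j] make its diagonal entries equal. *)
Lemma WBn_centralizer X : (forall v, is_root_Bn v -> X *m refl v = refl v *m X) ->
  exists l, X = l%:M.
Proof.
move=> cX.
have hX i : h i *m X = X i i *: h i.
  have [l el] := refl_comm_eigen (hvec_neq0 R i) (cX _ (is_root_hvec R i)).
  rewrite el; congr (_ *: _); have := congr1 (fun v : 'rV_n => v 0 i) el.
  by rewrite -rowh !mxE !eqxx mulr1.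
have diag i j : X i i = X j j.
  have [->//|nij] := eqVneq i j.
  have [l] := refl_comm_eigen (dvec_neq0 R false nij) (cX _ (is_root_dvec R false nij)).
  rewrite /dvec !scale1r mulmxDl !hX => el.
  have := congr1 (fun v : 'rV_n => v 0 i) el; have := congr1 (fun v : 'rV_n => v 0 j) el.
  rewrite !mxE !eqxx eq_sym (negPf nij) !mulr0 !mulr1 !addr0 !add0r !mulr1.
  by move=> -> ->.
case: (pickP 'I_n) => [i0 _ | n0].
  exists (X i0 i0); apply/row_matrixP => i.
  by rewrite !rowh hX mul_mx_scalar (diag i i0).
by exists 0; apply/matrixP => i; have := n0 i.
Qed.

(* The projection onto the coordinates of a connected component commutes with the group,
   while the centralizer of [W(B_n)] consists of scalar matrices. *)
Lemma generating_connected F : is_family F -> standard F -> generates_Bn F ->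
  forall i j, connect (adj (mult_of F)) i j.
Proof.
move=> fF sF [Q [oQ [_ genF]]] i j.
pose A a := connect (adj (mult_of F)) i a.
pose P : 'M[R]_n := diag_mx (\row_a (A a)%:R).
have uP u a : (u *m P) 0 a = u 0 a * (A a)%:R by rewrite mul_mx_diag !mxE.
have Aadj a b : adj (mult_of F) a b -> A a = A b.
  have sym: connect_sym (adj (mult_of F)).
    by apply: sym_connect_sym => x y; rewrite /adj mult_ofC.
  by move=> ab; rewrite /A; apply: (same_connect_r sym); apply: connect1.
(* No edge leaves the component, so each normal is supported inside or outside it, with eigenvalue 1
   or 0. *)
have eigP k : exists t, row k F *m P = t *: row k F.
  have [c [c0 [[a e] | [s [a [b [nab e]]]]]]] := standard_row k fF sF.
    exists (A a)%:R; apply/rowP => q; rewrite uP e !mxE eqxx /=.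
    by case: (eqVneq q a) => [->|_]; [rewrite mulr1 mulrC | rewrite !mulr0 mul0r].
  have Aab: A a = A b.
    apply/Aadj/(@occurs_mult_of _ s) => //.
    by apply/occursP => //; exists k, c.
  exists (A a)%:R; apply/rowP => q; rewrite uP e [RHS]mxE mulrC.
  have -> : (c *: dvec R s a b) 0 q = c * ((a == q)%:R + (-1) ^+ s * (b == q)%:R).
    by rewrite mxE dvecE.
  case: (eqVneq a q) => [->//|_]; case: (eqVneq b q) => [<-|_]; first by rewrite Aab.
  by rewrite mulr0 addr0 !mulr0.
have commP M : fam_group F M -> P *m M = M *m P.
  elim=> [|N f _ IH [k ->]]; first by rewrite mulmx1 mul1mx.
  rewrite mulmxA IH -!mulmxA; congr (_ *m _).
  have [t et] := eigP k; rewrite /refl mulmxBr mulmxBl mulmx1 mul1mx.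
  congr (_ - _); rewrite -scalemxAr -scalemxAl; congr (_ *: _).
  have -> : P = P^T by rewrite tr_diag_mx.
  by rewrite mulmxA -trmx_mul tr_diag_mx -mulmxA et linearZ /= -scalemxAl -scalemxAr.
have [l el] : exists l, Q^T *m P *m Q = l%:M.
  apply: WBn_centralizer => v rv.
  have := commP _ (genF _ (gen_refl rv)).
  move=> /(congr1 (fun Z => Q^T *m Z *m Q)).
  rewrite !mulmxA orth_trmul // mul1mx -!mulmxA orth_trmul // mulmx1.
  by rewrite !mulmxA.
have Pl: P = l%:M.
  have := congr1 (fun Z => Q *m Z *m Q^T) el.
  rewrite !mulmxA oQ mul1mx -mulmxA oQ mulmx1 => ->.
  by rewrite mul_mx_scalar -scalemxAl oQ scalemx1.
have := congr1 (fun Z : 'M_n => Z j j) Pl; have := congr1 (fun Z : 'M_n => Z i i) Pl.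
rewrite !mxE !eqxx !mulr1n /A connect0 => <- /eqP.
by case: connect => //; rewrite eq_sym oner_eq0.
Qed.

(** Among signed permutations this singles out W(D_n), where the number of sign changes is even. The
    first conjunct makes the property stable under products. *)
Definition preserves_sign_prod M := forall w, (forall i, w 0 i ^+ 2 = 1) ->
  (forall i, (w *m M) 0 i ^+ 2 = 1) /\ \prod_i (w *m M) 0 i = \prod_i w 0 i.

(** Coordinates [a] and [b] are exchanged with a common sign, which cancels in the product. *)
Lemma refl_dvec_sign_prod e a b : a != b -> preserves_sign_prod (refl (dvec R e a b)).
Proof.
move=> nab w w1; rewrite mul_refl_dvec //; set u := w - _.
have nba: b != a by rewrite eq_sym.
have uE i : u 0 i = w 0 i - (w 0 a + (-1) ^+ e * w 0 b) * ((a == i)%:R + (-1) ^+ e * (b == i)%:R).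
  by rewrite mxE [X in _ + X]mxE [X in _ - X]mxE dvecE.
have ua: u 0 a = - ((-1) ^+ e * w 0 b).
  by rewrite uE eqxx (negPf nba) /=; ring.
have ub: u 0 b = - ((-1) ^+ e * w 0 a).
  rewrite uE eqxx (negPf nab) add0r mulr1 mulrDl mulrAC -expr2 sqr_sign; ring.
have ui i : i != a -> i != b -> u 0 i = w 0 i.
  move=> nia nib; rewrite uE (eq_sym a) (eq_sym b) (negPf nia) (negPf nib) /=; ring.
split=> [i|].
  have [->|nia] := eqVneq i a; first by rewrite ua sqrrN exprMn sqr_sign mul1r.
  have [->|nib] := eqVneq i b; first by rewrite ub sqrrN exprMn sqr_sign mul1r.
  by rewrite ui.
rewrite (bigD1 a) //= (bigD1 b) //= [RHS](bigD1 a) //= [in RHS](bigD1 b) //= ua ub.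
rewrite !mulrA mulrNN [X in X * _ = _](_ : _ = w 0 a * w 0 b); last first.
  by rewrite mulrACA -expr2 sqr_sign mul1r mulrC.
by congr (_ * _); apply: eq_bigr => i /andP[nia nib]; rewrite ui.
Qed.

Lemma refl_hvec_sign_prod a : ~ preserves_sign_prod (refl (h a)).
Proof.
move=> /(_ (const_mx 1)) [i|_]; first by rewrite mxE expr1n.
have E i : ((const_mx 1 : 'rV_n) *m refl (h a)) 0 i = 1 - 2 * (a == i)%:R.
  by rewrite mul_refl dot_hh eqxx dot_hvec divr1 !mxE eqxx mulr1 eq_sym.
rewrite [RHS]big1; last by move=> i _; rewrite mxE.
rewrite (bigD1 a) //= big1 => [|i nia]; last first.
  by rewrite E eq_sym (negPf nia) mulr0 subr0.
by rewrite E eqxx /= => e; lra.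
Qed.

Lemma orth_mul_neq0 Q v : orthogonal_mx Q -> v != 0 -> v *m Q != 0.
Proof. by move=> oQ; rewrite -!dot_eq0 dot_orth. Qed.

Lemma refl_axes_sqr v : v != 0 -> permutes_axes (refl v) -> forall i,
  [\/ v 0 i = 0, 2 * v 0 i ^+ 2 = dot v v | v 0 i ^+ 2 = dot v v].
Proof.
move=> v0 /(refl_axes v0)[[a ->] | [e [a [b [nab ->]]]]] i; rewrite dotZl dotZr.
  rewrite dot_hh eqxx !mxE !eqxx /=.
  by case: eqVneq => _ /=; [apply: Or33 | apply: Or31]; ring.
rewrite dot_dvec // mxE dvecE; have [<-|nai] := eqVneq a i.
  by rewrite (eq_sym b) (negPf nab) /=; apply: Or32; ring.
have [_|nbi] := eqVneq b i; last first.
  by apply: Or31 => /=; ring.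
by apply: Or32; rewrite add0r mulr1 exprMn sqr_sign; ring.
Qed.

(* Without a marked vertex the group lies in [W(D_n)], which preserves the product of the
   coordinates of a sign vector; but [W(D_n)] contains no conjugate of [W(B_n)]. *)
Lemma generating_marked F : (2 <= n)%N ->
  is_family F -> standard F -> generates_Bn F -> exists r, mark_of F r.
Proof.
move=> n2 fF sF [Q [oQ [_ genF]]].
apply/existsP; apply: contraT; rewrite negb_exists => /forallP nomark.
have signF M : fam_group F M -> preserves_sign_prod M.
  elim=> [|N f _ IH [k ->]] w w1; first by rewrite mulmx1.
  have [wN pN] := IH w w1; rewrite mulmxA -pN.
  have [c [c0 [[i e] | [e [i [j [nij e']]]]]]] := standard_row k fF sF.
    by have /occursP[] := nomark i => //; exists k, c.
  by rewrite e' reflZ //; apply: refl_dvec_sign_prod.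
have oQ' := orth_tr oQ.
(* The image of a root lies on the line of a long root, since [signF] excludes the short ones. *)
have sq v i : is_root_Bn v -> v != 0 ->
    (v *m Q^T) 0 i = 0 \/ 2 * (v *m Q^T) 0 i ^+ 2 = dot v v.
  move=> rv v0; have u0 := orth_mul_neq0 oQ' v0.
  have gu: fam_group F (refl (v *m Q^T)).
    by rewrite refl_mul // trmxK; apply/genF/gen_refl.
  have /(refl_axes u0) := WBn_axes (standard_WBn fF sF gu).
  case=> [[a ua] | [e [a [b [nab ua]]]]].
    have : (v *m Q^T) 0 a != 0 by apply: contraNneq u0 => e; rewrite ua e scale0r.
    by move=> ua0; have := signF _ gu; rewrite ua reflZ // => /refl_hvec_sign_prod.
  rewrite -(dot_orth v v oQ') ua dotZl dotZr dot_dvec // mxE dvecE.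
  have [<-|nai] := eqVneq a i.
    by right; rewrite (eq_sym b) (negPf nab) /=; ring.
  have [_|nbi] := eqVneq b i; last first.
    by left => /=; ring.
  by right; rewrite add0r mulr1 exprMn sqr_sign; ring.
pose i : 'I_n := Ordinal (ltnW n2); pose j : 'I_n := Ordinal n2.
have nij: i != j by [].
have [a xa]: exists a, Q^T i a != 0.
  have := orth_mul_neq0 oQ' (hvec_neq0 R i); rewrite -rowh => Qi.
  apply/existsP; apply: contraNT Qi; rewrite negb_exists => /forallP Qi.
  by apply/eqP/rowP => a; rewrite !mxE; apply/eqP; move: (Qi a); rewrite negbK mxE.
have sx := sq _ a (is_root_hvec R i) (hvec_neq0 R i).
have sy := sq _ a (is_root_hvec R j) (hvec_neq0 R j).
have sp := sq _ a (is_root_dvec R false nij) (dvec_neq0 R false nij).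
have sm := sq _ a (is_root_dvec R true nij) (dvec_neq0 R true nij).
(* Here [x ^+ 2 = 1/2]. If [y = 0], the image of [h i + h j] has coordinate [x], whose square would
   have to be 0 or 1. *)
move: sx sy sp sm; rewrite !dot_hh !dot_dvec // !eqxx !dvec_mulE !hvec_mulE /=.
move: (Q^T i a) (Q^T j a) xa => x y x0.
case=> [/eqP|x2]; first by rewrite (negPf x0).
case=> [->|y2].
  rewrite !mulr0 !addr0; case=> [/eqP|x2' _]; first by rewrite (negPf x0).
  by lra.
(* If [y ^+ 2 = 1/2], the squares of [x + y] and [x - y] are each 0 or 1 and add up to 2, yet their
   product is 0. *)
have pr : (x + 1 * y) ^+ 2 * (x + (-1) * y) ^+ 2 = (x ^+ 2 - y ^+ 2) ^+ 2 by ring.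
have sm : (x + 1 * y) ^+ 2 + (x + (-1) * y) ^+ 2 = 2 * x ^+ 2 + 2 * y ^+ 2 by ring.
move: pr sm; rewrite expr0 expr1.
move: (x + 1 * y) (x + -1 * y) => s t pr sm [s0|s2] [t0|t2]; move: pr sm; rewrite ?s0 ?t0.
- by move=> _; lra.
- by move=> _; lra.
- by move=> _; lra.
- have -> : x ^+ 2 = 1 / 2 by lra.
  have -> : y ^+ 2 = 1 / 2 by lra.
  have -> : s ^+ 2 = 1 by lra.
  have -> : t ^+ 2 = 1 by lra.
  by move=> h1; lra.
Qed.

End Families.

(** * Rooted families *)

Section RootedFamilies.
Variables (R : realType) (n : nat).
Implicit Types (f g u v w : 'rV[R]_n) (F M N Q : 'M[R]_n).
Implicit Types (r : 'I_n) (p : 'I_n -> 'I_n) (d : 'I_n -> nat) (e : 'I_n -> bool).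
Local Notation h := (@hvec R n).
Local Notation dv := (@dvec R n).

Definition tree_vec r p e i : 'rV[R]_n := if i == r then h i else dv (e i) i (p i).

(** An injective [k] on a finite set is bijective, so the tree vectors account for every row; [c]
    absorbs the normalization. *)
Definition rooted F r p d e : Prop := parent_fun r p d /\
  exists (k : 'I_n -> 'I_n) (c : 'I_n -> R), injective k /\
    forall i, c i != 0 /\ row (k i) F = c i *: tree_vec r p e i.

Lemma vsupp_tree_vec r p d e i : parent_fun r p d ->
  vsupp (tree_vec r p e i) = [set i; p i].
Proof.
move=> pf; rewrite /tree_vec; have [->|nir] := eqVneq i r.
  by rewrite vsupp_hvec; case: pf => -> _; rewrite setUid.
by rewrite vsupp_dvec // eq_sym (parent_neq pf).
Qed.

Lemma generating_rooted F : (2 <= n)%N ->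
  is_family F -> standard F -> generates_Bn F -> exists r p d e, rooted F r p d e.
Proof.
move=> n2 fF sF gF.
have [r mr] := generating_marked n2 fF sF gF.
have conn := generating_connected fF sF gF.
have [p [d [pf adjp]]] := connected_parent (fun i => conn i r).
have step i : exists x : 'I_n * R * bool, x.1.2 != 0 /\
    row x.1.1 F = x.1.2 *: tree_vec r p (fun=> x.2) i.
  rewrite /tree_vec; have [->|nir] := eqVneq i r.
    by have /occursP[//|k [c [c0 ek]]] := mr; exists (k, c, false).
  have [_ [e /occursP[//|k [c [c0 ek]]]]] := mult_of_gt0 (adjp i nir).
  by exists (k, c, e).
have [x xP] := fin_all_exists step; exists r, p, d, (fun i => (x i).2); split=> //.
(* Different vertices use different rows because the supports [[set i; p i]] differ. *)
exists (fun i => (x i).1.1), (fun i => (x i).1.2); split=> // i j eij.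
have S q : vsupp (row (x q).1.1 F) = [set q; p q].
  by have [c0 ->] := xP q; rewrite vsuppZ // (vsupp_tree_vec _ _ pf).
by apply: (set2_parent_inj pf); rewrite -!S eij.
Qed.

Lemma rooted_row F r p d e q : rooted F r p d e ->
  exists i c, c != 0 /\ row q F = c *: tree_vec r p e i.
Proof.
case=> _ [k [c [ik kc]]]; have [k' kk' k'k] := injF_bij ik.
by exists (k' q), (c (k' q)); have := kc (k' q); rewrite k'k.
Qed.

Lemma rooted_vsupp F r p d e q c v : rooted F r p d e -> c != 0 ->
  row q F = c *: v -> exists i c', [/\ c' != 0, vsupp v = [set i; p i] & v = c' *: tree_vec r p e i].
Proof.
move=> rF c0 ev; have [pf _] := rF; have [i [c' [c'0 ei]]] := rooted_row q rF.
have vE: v = (c^-1 * c') *: tree_vec r p e i.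
  by rewrite -scalerA -ei ev scalerA mulVf // scale1r.
have cc0: c^-1 * c' != 0 by rewrite mulf_neq0 // invr_eq0.
exists i, (c^-1 * c'); split=> //.
by rewrite vE vsuppZ // (vsupp_tree_vec _ _ pf).
Qed.

Lemma rooted_mark F r p d e i : is_family F -> rooted F r p d e ->
  mark_of F i = (i == r).
Proof.
move=> fF rF; have [pf [k [c [_ kc]]]] := rF.
apply/idP/eqP => [/occursP[//|q [c' [c'0 eq']]] | ->].
  (* A singleton support forces [p j = j], which happens only at the root. *)
  have [j [_ [_ sE _]]] := rooted_vsupp rF c'0 eq'.
  have: j \in [set i] by rewrite -(vsupp_hvec R) sE !inE eqxx.
  have: p j \in [set i] by rewrite -(vsupp_hvec R) sE !inE eqxx orbT.
  rewrite !inE => /eqP pji /eqP ji; rewrite -ji; apply/eqP; apply: contraT => njr.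
  by have := parent_neq pf njr; rewrite pji ji eqxx.
apply/occursP => //; exists (k r), (c r); have := kc r.
by rewrite /tree_vec eqxx.
Qed.

Lemma rooted_mult F r p d e i j : is_family F -> rooted F r p d e ->
  mult_of F i j = parent_adj r p i j.
Proof.
move=> fF rF; have [pf [k [c [_ kc]]]] := rF.
have key a : a != r -> mult_of F a (p a) = 1%N.
  move=> nar; have npa: a != p a by rewrite eq_sym (parent_neq pf).
  have oe: occurs F (dv (e a) a (p a)).
    by apply/occursP => //; exists (k a), (c a); have := kc a; rewrite /tree_vec (negPf nar).
  (* The opposite sign has the same support, so it would come from the vertex [a] too; coordinates
     [a] and [p a] then require incompatible scalars. *)
  have one: ~~ occurs F (dv (~~ e a) a (p a)).
    apply/negP => /occursP[//|q [c' [c'0 eq']]].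
    have [b [c2 [c20 sE E]]] := rooted_vsupp rF c'0 eq'.
    move: sE; rewrite vsupp_dvec // => /(set2_parent_inj pf) eba; subst b.
    move: E; rewrite /tree_vec (negPf nar) => E.
    have := congr1 (fun v : 'rV_n => v 0 a) E.
    have := congr1 (fun v : 'rV_n => v 0 (p a)) E.
    rewrite [X in _ = X -> _]mxE [X in _ -> _ = X -> _]mxE !dvecE !eqxx (eq_sym (p a) a).
    rewrite (negPf npa) signrN /= => e1 e2.
    have s2 := sqr_sign R (e a).
    have c21: c2 = 1 by lra.
    have: ((-1) ^+ e a : R) = 0 by move: e1; rewrite c21; lra.
    by move/eqP; rewrite signr_eq0.
  by rewrite mult_ofE (negPf npa); case: (e a) oe one => -> /negPf->.
have [<-|nij] := eqVneq i j.
  rewrite mult_ofE eqxx /parent_adj orbb.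
  by have [//|/(parent_neq pf)/negPf->] := eqVneq i r.
case: (boolP (parent_adj r p i j)) => [/orP[] /andP[nr /eqP<-]|nadj]; first exact: key.
  by rewrite mult_ofC; apply: key.
apply/eqP; rewrite -leqn0 leqNgt; apply: contra nadj => /mult_of_gt0[_ [s]].
case/occursP=> // q [c' [c'0 eq']].
have [b [c2 [_ + _]]] := rooted_vsupp rF c'0 eq'; rewrite vsupp_dvec // => sE.
have: i \in [set b; p b] by rewrite -sE !inE eqxx.
have: j \in [set b; p b] by rewrite -sE !inE eqxx orbT.
have nbr: b != r.
  apply: contraNneq nij => br; move: sE; rewrite br; case: pf => -> _; rewrite setUid => sE.
  have: i \in [set r] by rewrite -sE !inE eqxx.
  have: j \in [set r] by rewrite -sE !inE eqxx orbT.
  by rewrite !inE => /eqP-> /eqP->.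
rewrite !inE => /orP[] /eqP ej /orP[] /eqP ei; rewrite /parent_adj.
- by rewrite ei ej eqxx in nij.
- by rewrite ej nbr ei eqxx orbT.
- by rewrite ei nbr ej eqxx.
- by rewrite ei ej eqxx in nij.
Qed.

Lemma rooted_generates F r p d e M : rooted F r p d e -> WBn M -> fam_group F M.
Proof.
move=> [pf [k [c [_ kc]]]].
pose G := fam_group F.
have GZ (x : R) v : x != 0 -> G (refl (x *: v)) -> G (refl v) by move=> x0; rewrite reflZ.
have tree i : G (refl (tree_vec r p e i)).
  by have [c0 ek] := kc i; apply: (GZ (c i)) => //; rewrite -ek; apply: gen_refl; exists (k i).
have treeN i : i != r -> G (refl (dv (e i) i (p i))).
  by move=> nir; have := tree i; rewrite /tree_vec (negPf nir).
(* Reflecting [h (p i)] in the edge of [i] gives [h i] up to sign. *)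
have Gh i : G (refl (h i)).
  move: i; apply: (parent_fun_ind pf) => [|i nir Gp].
    by have := tree r; rewrite /tree_vec eqxx.
  have := gen_refl_mul (treeN i nir) Gp.
  by rewrite hvec_refl_dvecr ?reflZ ?signr_eq0 // eq_sym (parent_neq pf).
have flip s s' i j : i != j -> G (refl (dv s i j)) -> G (refl (dv s' i j)).
  move=> nij Gij; have := gen_refl_mul (Gh j) Gij.
  have -> : dv s i j *m refl (h j) = dv (~~ s) i j.
    by rewrite /dvec mulmxDl -scalemxAl !mul_refl_hvec eqxx (negPf nij) scale1r scaleN1r scalerN signrN scaleNr.
  by case: (eqVneq s s') => [<-//|]; case: s s' Gij => [] [].
have Gr i : i != r -> forall s, G (refl (dv s i r)).
  move: i; apply: (parent_fun_ind pf).
    by rewrite eqxx.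
  move=> i nir IH _ s; have npi: i != p i by rewrite eq_sym (parent_neq pf).
  have [pr|npr] := eqVneq (p i) r.
    by have := treeN i nir; rewrite pr; apply: flip.
  (* Reflection in the edge of [i] replaces [h (p i)] by a signed [h i] and fixes [h r]. *)
  have := gen_refl_mul (treeN i nir) (IH npr s).
  rewrite /dvec mulmxDl -scalemxAl -/(dv _ _ _) hvec_refl_dvecr // hvec_refl_dvec_id //; last by rewrite eq_sym.
    have -> : (-1) ^+ (~~ e i) *: h i + (-1) ^+ s *: h r = (-1) ^+ (~~ e i) *: dv (s (+) ~~ e i) i r.
      by rewrite /dvec scalerDr scalerA -signr_addb addbC -addbA addbb addbF.
    by rewrite reflZ ?signr_eq0 //; apply: flip.
  by rewrite eq_sym.
have Gd s i j : i != j -> G (refl (dv s i j)).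
  move=> nij; have [ir|nir] := eqVneq i r.
    rewrite dvecC reflZ ?signr_eq0 // ir; apply: Gr.
    by rewrite -ir eq_sym.
  have [->|njr] := eqVneq j r; first exact: Gr.
  (* Reflecting [h i - h r] in [dv s j r] replaces [h r] by a signed [h j]. *)
  have := gen_refl_mul (Gr j njr s) (Gr i nir true).
  rewrite {2}/dvec mulmxDl -scalemxAl hvec_refl_dvec_id // hvec_refl_dvecr //.
  by rewrite scalerA -signr_addb; apply: flip.
apply: gen_sub => f /is_rootP[x [x0 [[i ->] | [s [i [j [nij ->]]]]]]]; rewrite reflZ //.
  exact: Gh.
exact: Gd.
Qed.

(** * Isometries versus graph isomorphisms *)

Lemma isometric_rows F F' Q : is_family F -> is_family F' -> orthogonal_mx Q ->
  (forall k, exists q (c : R), row k F *m Q = c *: row q F') -> isometric F F'.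
Proof.
move=> fF fF' oQ rows; exists Q; split=> //.
have pm k : exists q, row k F *m Q = row q F' \/ row k F *m Q = - row q F'.
  have [q [c eq']] := rows k; exists q.
  have := dot_orth (row k F) (row k F) oQ.
  rewrite eq' dotZl dotZr !family_dot // mulr1 -expr2 => /eqP.
  by rewrite sqrf_eq1 => /orP[]/eqP->; [left | right]; rewrite ?scale1r ?scaleN1r.
have [s sP] := fin_all_exists pm.
have sI : injective s.
  (* Two rows sent to the same line would pull back to proportional basis vectors. *)
  move=> a b sab; have inv k : row k F *m Q *m (Q^T *m invmx F) = h k.
    case: fF => uF _.
    by rewrite mulmxA -(mulmxA _ Q) oQ mulmx1 -row_mul mulmxV // rowE mulmx1.
  have: h a = h b \/ h a = - h b.
    rewrite -(inv a) -(inv b).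
    by case: (sP a) (sP b) => -> [] ->; rewrite sab ?mulNmx ?opprK; [left|right|right|left].
  have := hvecE R a a; rewrite eqxx => ha [] e; apply/eqP; apply: contraT => nab.
    by move: ha; rewrite e hvecE eq_sym (negPf nab) => /eqP; rewrite eq_sym oner_eq0.
  by move: ha; rewrite e mxE hvecE eq_sym (negPf nab) oppr0 => /eqP; rewrite eq_sym oner_eq0.
by exists (perm sI) => k; rewrite permE.
Qed.

Lemma isometric_signed_perm F F' Q (t : 'S_n) : is_family F -> is_family F' ->
  orthogonal_mx Q -> permutes_axes Q ->
  (forall k, row k F *m Q = row (t k) F' \/ row k F *m Q = - row (t k) F') ->
  mg_iso (mult_of F) (mark_of F) (mult_of F') (mark_of F').
Proof.
move=> fF fF' oQ aQ rows.
have step i : exists x : 'I_n * bool, h i *m Q = (-1) ^+ x.2 *: h x.1.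
  by have [j [e ej]] := aQ i; exists (j, e).
have [x xP] := fin_all_exists step.
have sI : injective (fun i => (x i).1).
  move=> i j exij; have := dot_orth (h i) (h j) oQ.
  rewrite !xP exij dotZl dotZr !dot_hh eqxx mulr1 -signr_addb.
  by case: eqVneq => //= _ /eqP; rewrite signr_eq0.
have occ v : occurs F v = occurs F' (v *m Q).
  apply/occursP/occursP => // [] [k [c [c0 ek]]].
    have := rows k; rewrite ek -scalemxAl => -[] et.
      by exists (t k), c; rewrite et.
    by exists (t k), (- c); rewrite oppr_eq0 scaleNr et opprK.
  have := rows (t^-1%g k); rewrite permKV ek.
  case=> /(congr1 (fun u => u *m Q^T)).
    by rewrite -mulmxA oQ mulmx1 -scalemxAl -mulmxA oQ mulmx1 => et; exists (t^-1%g k), c.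
  rewrite -mulmxA oQ mulmx1 mulNmx -scalemxAl -mulmxA oQ mulmx1 => et.
  by exists (t^-1%g k), (- c); rewrite oppr_eq0 scaleNr.
exists (perm sI); split=> [i j|i]; last first.
  by rewrite permE /mark_of occ xP occursZ ?signr_eq0.
rewrite !mult_ofE !permE (inj_eq sI); case: eqVneq => // nij.
(* The axis signs of [Q] keep or exchange the two signs of an edge, and the multiplicity is
   symmetric in them. *)
have E (b : bool) :
    occurs F (dv b i j) = occurs F' (dv (b (+) ((x i).2 (+) (x j).2)) (x i).1 (x j).1).
  rewrite occ -[RHS](@occursZ R n F' ((-1) ^+ (x i).2)) ?signr_eq0 //; congr occurs.
  rewrite /dvec mulmxDl -scalemxAl !xP scalerDr !scalerA -!signr_addb.
  by case: b (x i).2 (x j).2 => [] [] [].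
rewrite !E addFb addTb; case: (_ (+) _) => //.
exact: addnC.
Qed.

(* The squared entries of [Q] lie in {0, 1/2, 1}.  If [Q i a ^+ 2 = 1/2], applying this to
   [h_i + h_j] forces [Q j a != 0] for every [j], so column [a] has norm at least [n / 2]. *)
Lemma normalizer_axes Q : (3 <= n)%N -> orthogonal_mx Q ->
  (forall v, is_root_Bn v -> permutes_axes (refl (v *m Q))) -> permutes_axes Q.
Proof.
move=> n3 oQ aQ i.
have sq v a : is_root_Bn v -> v != 0 ->
  [\/ (v *m Q) 0 a = 0, 2 * (v *m Q) 0 a ^+ 2 = dot v v | (v *m Q) 0 a ^+ 2 = dot v v].
  move=> rv v0; rewrite -(dot_orth v v oQ).
  by apply: refl_axes_sqr; [apply: orth_mul_neq0 | apply: aQ].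
have := dot_orth (h i) (h i) oQ; rewrite dot_hh eqxx.
have := refl_axes (orth_mul_neq0 oQ (hvec_neq0 R i)) (aQ _ (is_root_hvec R i)).
case=> [[a ->] | [e [a [b [nab ->]]]]].
  rewrite dotZl dotZr dot_hh eqxx mulr1 -expr2 hvec_mulE => /eqP.
  rewrite sqrf_eq1 => /orP[]/eqP->; exists a; first by exists false.
  by exists true.
rewrite dotZl dotZr dot_dvec // hvec_mulE /= => xx; exfalso.
have x2: Q i a ^+ 2 = 1 / 2 by move: xx; rewrite mulrA -expr2 => xx; lra.
have y2 j : j != i -> 1 / 2 <= Q j a ^+ 2.
  rewrite eq_sym => nij.
  have := sq _ a (is_root_dvec R false nij) (dvec_neq0 R false nij).
  have := sq _ a (is_root_hvec R j) (hvec_neq0 R j).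
  rewrite dot_hh dot_dvec // eqxx dvec_mulE hvec_mulE expr0 mul1r /=.
  by case=> [-> | y2 _ | y2 _]; [rewrite addr0 x2; case=> [x0|x1|x1]; move: x2; rewrite ?x0 => x2 | |]; lra.
have [j [l [nj nl njl]]] : exists j l, [/\ j != i, l != i & l != j].
  have: (1 < #|[set~ i]|)%N by rewrite cardsC1 card_ord; case: n n3 => [|[|[]]].
  by case/card_gt1P => j [l]; rewrite !inE => -[nj nl njl]; exists j, l; rewrite (eq_sym l j).
(* Column [a] has norm 1, but its entries in rows [i], [j], [l] already contribute at least 3/2. *)
have := dot_orth (h a) (h a) (orth_tr oQ); rewrite dot_hh eqxx dotE.
under eq_bigr => k _ do rewrite hvec_mulE mxE -expr2.
rewrite (bigD1 i) //= (bigD1 j) //= (bigD1 l) ?nl //=.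
have rest : 0 <= \sum_(k | [&& k != i, k != j & k != l]) Q k a ^+ 2.
  by apply: sumr_ge0 => k _; apply: sqr_ge0.
have yj := y2 j nj; have yl := y2 l nl.
under eq_bigl => k do rewrite -andbA.
by move=> s1; lra.
Qed.

(** Iterating [step] stabilizes the value at [i] after [d i + 1] rounds, and [N] exceeds every
    [d i]. *)
Lemma parent_rec r p d (g : 'I_n -> bool) : parent_fun r p d ->
  exists x : 'I_n -> bool, forall i, i != r -> x i = g i (+) x (p i).
Proof.
move=> [_ pd]; pose step (x : 'I_n -> bool) i := if i == r then false else g i (+) x (p i).
pose N := (\max_i d i).+1; pose x k := iter k step (fun=> false).
have stab k i : (d i < k)%N -> x k.+1 i = x k i.
  elim: k i => // k IH i; rewrite ltnS => le_dk.
  rewrite [LHS]/= [RHS]/= /step; case: eqVneq => // nir; congr (_ (+) _).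
  by apply: IH; apply: leq_trans (pd i nir) le_dk.
exists (x N) => i nir; rewrite -stab; last by rewrite ltnS leq_bigmax.
by rewrite [LHS]/= /step (negPf nir).
Qed.

Lemma rooted_isometric F F' r p d e (s : 'S_n) :
  is_family F -> is_family F' -> rooted F r p d e ->
  mark_of F' (s r) -> (forall i, i != r -> (0 < mult_of F' (s i) (s (p i)))%N) ->
  isometric F F'.
Proof.
move=> fF fF' rF mr adj'; have [pf _] := rF.
have step i : exists x : bool, exists q (c : R), c != 0 /\
    row q F' = c *: (if i == r then h (s i) else dv x (s i) (s (p i))).
  have [->|nir] := eqVneq i r.
    by have /occursP[//|q [c qc]] := mr; exists false, q, c.
  have [_ [x /occursP[//|q [c qc]]]] := mult_of_gt0 (adj' i nir).
  by exists x, q, c.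
have [e' eP] := fin_all_exists step.
(* Sending [h i] to [(-1) ^+ x i *: h (s i)] turns the edge sign [e i] into
   [e i (+) x i (+) x (p i)], which has to be [e' i]. *)
have [x xP] := parent_rec (fun i => e i (+) e' i) pf.
pose Q : 'M[R]_n := \matrix_i ((-1) ^+ x i *: h (s i)).
have hQ i : h i *m Q = (-1) ^+ x i *: h (s i) by rewrite -rowh rowK.
have oQ : orthogonal_mx Q.
  apply/matrixP => i j; rewrite [RHS]mxE.
  have -> : (Q *m Q^T) i j = dot (row i Q) (row j Q).
    by rewrite dotE mxE; apply: eq_bigr => k _; rewrite !mxE.
  rewrite !rowK dotZl dotZr dot_hh (inj_eq perm_inj).
  by case: eqVneq => [->|_]; rewrite ?mulr0 // mulr1 -expr2 sqr_sign.
apply: (isometric_rows fF fF' oQ) => k.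
have [i [c [c0 ->]]] := rooted_row k rF; have [q [c' [c'0 eq']]] := eP i.
suff E : tree_vec r p e i *m Q = (-1) ^+ x i *: (if i == r then h (s i) else dv (e' i) (s i) (s (p i))).
  exists q, (c * (-1) ^+ x i / c').
  by rewrite eq' -scalemxAl E !scalerA mulfVK.
rewrite /tree_vec; case: eqVneq => [->|nir]; first by rewrite hQ.
rewrite /dvec mulmxDl -scalemxAl !hQ scalerDr !scalerA -!signr_addb (xP i nir).
by case: (e i) (e' i) (x (p i)) => [] [] [].
Qed.

(** With all edge signs negative, [h i] is the telescoping sum of the tree vectors on the path to
    the root, so the rows span. *)
Lemma tree_family_exists r p d : parent_fun r p d ->
  exists F, [/\ is_family F, standard F & rooted F r p d (fun=> true)].
Proof.
move=> pf; pose t := tree_vec r p (fun=> true).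
have npi i : i != r -> i != p i by move=> nir; rewrite eq_sym (parent_neq pf).
pose c i : R := if i == r then 1 else (Num.sqrt 2)^-1.
have c0 i : c i != 0.
  rewrite /c; case: ifP => _; first exact: oner_neq0.
  by rewrite invr_eq0 sqrtr_eq0 -ltNge ltr0n.
pose F : 'M[R]_n := \matrix_i (c i *: t i).
have rF i : row i F = c i *: t i by rewrite rowK.
have tF i : (t i <= F)%MS.
  by rewrite -(eqmx_scale _ (c0 i)) -rF row_sub.
exists F; split; last by split=> //; exists id, c; split=> // i; split=> //.
  split=> [|i]; last first.
    rewrite rF mulmx_dot dotZl dotZr /c /t /tree_vec; congr _%:M.
    have [_|nir] := eqVneq i r; first by rewrite dot_hh eqxx !mulr1.
    by rewrite dot_dvec ?npi // mulrA -invfM -expr2 sqr_sqrtr ?ler0n // mulVf ?pnatr_eq0.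
  rewrite -row_full_unit -sub1mx; apply/row_subP => i; rewrite rowh mulmx1.
  move: i; apply: (parent_fun_ind pf) => [|i nir IH].
    by have := tF r; rewrite /t /tree_vec eqxx.
  have -> : h i = t i + h (p i).
    by rewrite /t /tree_vec (negPf nir) /dvec expr1 scaleN1r subrK.
  exact: addmx_sub (tF i) IH.
move=> i; exists (c i), (t i); split=> //; rewrite /t /tree_vec.
case: eqVneq => [_|nir]; first exact: is_root_hvec.
by apply/is_root_dvec/npi.
Qed.

Lemma rooted_generates_Bn F r p d e :
  is_family F -> standard F -> rooted F r p d e -> generates_Bn F.
Proof.
move=> fF sF rF; exists 1%:M; rewrite /orthogonal_mx trmx1 mulmx1.
split=> //; split=> M; rewrite mul1mx mulmx1; first exact: standard_WBn.
exact: rooted_generates rF.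
Qed.

(** The reflection in [row k F *m Q] lies in W(B_n), hence permutes the axes, and [refl_axes] puts
    this row on the line of a root. *)
Lemma generating_standard F : is_family F -> generates_Bn F ->
  exists Q, orthogonal_mx Q /\ standard (F *m Q).
Proof.
move=> fF [Q [oQ [FW _]]]; exists Q; split=> // k.
have f0 := orth_mul_neq0 oQ (family_row_neq0 k fF).
have Wf: WBn (refl (row k F *m Q)).
  by rewrite refl_mul //; apply/FW/gen_refl; exists k.
rewrite row_mul; have [[a fE] | [s [a [b [nab fE]]]]] := refl_axes f0 (WBn_axes Wf).
  by exists ((row k F *m Q) 0 a), (h a); split=> //; apply: is_root_hvec.
by exists ((row k F *m Q) 0 a), (dv s a b); split=> //; apply: is_root_dvec.
Qed.

Lemma ord2_neq_eq (i j k : 'I_n) : (n <= 2)%N -> i != j -> i != k -> j = k.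
Proof.
move=> n2 nij nik; apply: val_inj; move: nij nik; rewrite -!(inj_eq val_inj) /=.
have lt2 (l : 'I_n) : (l < 2)%N := leq_trans (ltn_ord l) n2.
by case: (val i) (lt2 i) => [|[|]] //; case: (val j) (lt2 j) => [|[|]] //;
   case: (val k) (lt2 k) => [|[|]].
Qed.

(** A non-root has only the other vertex as possible parent, so the graph does not depend on the
    root. *)
Lemma parent_adj_ord2 r p d i j : (n <= 2)%N -> parent_fun r p d ->
  parent_adj r p i j = (i != j).
Proof.
move=> n2 pf; rewrite /parent_adj; have [<-|nij] /= := eqVneq i j.
  by rewrite orbb; have [//|/(parent_neq pf)/negPf->] := eqVneq i r.
have [ir|nir] /= := eqVneq i r.
  have njr: j != r by rewrite -ir eq_sym.
  rewrite njr; apply/eqP/(@ord2_neq_eq j) => //; first by rewrite eq_sym (parent_neq pf).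
  by rewrite eq_sym.
by apply/orP; left; apply/eqP/(@ord2_neq_eq i) => //; rewrite eq_sym (parent_neq pf).
Qed.

Lemma isometric_mg_iso F F' : (2 <= n)%N ->
  is_family F -> standard F -> generates_Bn F ->
  is_family F' -> standard F' -> generates_Bn F' ->
  isometric F F' -> mg_iso (mult_of F) (mark_of F) (mult_of F') (mark_of F').
Proof.
move=> n2 fF sF gF fF' sF' gF' [Q [oQ [t tP]]].
have [r [p [d [e rF]]]] := generating_rooted n2 fF sF gF.
have [r' [p' [d' [e' rF']]]] := generating_rooted n2 fF' sF' gF'.
(* For [n = 2] the rotation by pi/4 normalizes W(B_2) without being a signed permutation; exchanging
   [r] and [r'] serves instead. *)
have [n3|n3] := ltnP 2 n; last first.
  have [pf _] := rF; have [pf' _] := rF'.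
  exists (tperm r r'); split=> [i j|i].
    rewrite (rooted_mult _ _ fF rF) (rooted_mult _ _ fF' rF').
    by rewrite !(parent_adj_ord2 _ _ n3 pf) !(parent_adj_ord2 _ _ n3 pf') (inj_eq perm_inj).
  rewrite (rooted_mark _ fF rF) (rooted_mark _ fF' rF').
  by rewrite -{2}(tpermL r r') (inj_eq perm_inj).
(* Conjugation by [Q] carries W(B_n), contained in the group of [F], into the group of [F'], which
   lies in W(B_n). *)
apply: (isometric_signed_perm fF fF' oQ _ tP); apply: normalizer_axes => // v rv.
apply: WBn_axes; apply: (standard_WBn fF' sF'); rewrite refl_mul //.
have := rooted_generates rF (gen_refl rv); apply: gen_conj => // f [k ->].
have [-> | ->] := tP k; first by apply: gen_refl; exists (t k).
rewrite -scaleN1r reflZ ?oppr_eq0 ?oner_eq0 //.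
by apply: gen_refl; exists (t k).
Qed.

End RootedFamilies.

Theorem theorem2 (R : realType) (n : nat) : (2 <= n)%N ->
  [/\
   (* every family generating B_n can be realized in Delta(B_n) *)
   (forall F : 'M[R]_n, is_family F -> generates_Bn F ->
      exists Q : 'M[R]_n, orthogonal_mx Q /\ standard (F *m Q)),
   (* the associated graph is a tree with exactly one marked vertex *)
   (forall F : 'M[R]_n, is_family F -> standard F -> generates_Bn F ->
      is_tree (mult_of F) /\ one_marked (mark_of F)),
   (* well defined on isometry classes *)
   (forall F F' : 'M[R]_n,
      is_family F -> standard F -> generates_Bn F ->
      is_family F' -> standard F' -> generates_Bn F' ->
      isometric F F' -> mg_iso (mult_of F) (mark_of F) (mult_of F') (mark_of F')),
   (* injective on isometry classes *)
   (forall F F' : 'M[R]_n,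
      is_family F -> standard F -> generates_Bn F ->
      is_family F' -> standard F' -> generates_Bn F' ->
      mg_iso (mult_of F) (mark_of F) (mult_of F') (mark_of F') -> isometric F F') &
   (* surjective onto marked trees *)
   (forall (m : 'I_n -> 'I_n -> nat) (mk : 'I_n -> bool),
      is_tree m -> one_marked mk ->
      exists F : 'M[R]_n, [/\ is_family F, standard F, generates_Bn F &
                              mg_iso (mult_of F) (mark_of F) m mk])].
Proof.
move=> n2; split.
- exact: generating_standard.
- move=> F fF sF gF; have [r [p [d [e rF]]]] := generating_rooted n2 fF sF gF.
  split; first by have [pf _] := rF; apply: (parent_tree pf) => i j; apply: rooted_mult rF.
  rewrite /one_marked (_ : [set i | mark_of F i] = [set r]) ?cards1 //.
  by apply/setP => i; rewrite !inE (rooted_mark _ fF rF).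
- by move=> F F'; apply: isometric_mg_iso.
- move=> F F' fF sF gF fF' sF' gF' [s [mult_s mark_s]].
  have [r [p [d [e rF]]]] := generating_rooted n2 fF sF gF.
  apply: (rooted_isometric (s := s) fF fF' rF) => [|i nir].
    by rewrite mark_s (rooted_mark _ fF rF) eqxx.
  by rewrite mult_s (rooted_mult _ _ fF rF) /parent_adj nir eqxx.
- move=> m mk tm /eqP/cards1P[r mkr].
  have [p [d [pf mE]]] := tree_parent r tm.
  have [F [fF sF rF]] := tree_family_exists R pf.
  exists F; split=> //; first exact: rooted_generates_Bn rF.
  (* Rooting the tree at its marked vertex keeps the labels: the graph of [F] is the given tree
     itself. *)
  exists 1%g; split=> [i j|i]; rewrite !perm1.
    by rewrite mE (rooted_mult _ _ fF rF).
  by rewrite (rooted_mark _ fF rF) -[RHS]in_set1 -mkr inE.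
Qed.
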